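(* Let $q$ be a prime power and let $s$ be an odd prime with $s\ge q$ and $s\nmid q^2+1$. Let $G$ be an abelian group of order $(q^s+1)(q^{2s}+1)$ and let $D$ be a normalized difference set in $G$ with parameters \[ (v,k,\lambda)=\left((q^s+1)(q^{2s}+1),\,q^{2s}+q^s+1,\,q^s+1\right). \] Let $M$ be a subgroup of $G$ of order $(q+1)(q^2+1)$. Then $D\cap M$ is a normalized difference set in $M$ with parameters $\left((q+1)(q^2+1),\,q^2+q+1,\,q+1\right)$.
   Context: A $(v,k,\lambda)$-difference set in an abelian group $G$ of order $v$ is a $k$-subset $D$ such that every non-identity element of $G$ is of the form $d_1d_2^{-1}$ with $d_1,d_2\in D$ in exactly $\lambda$ ways. It is normalized if $\prod_{d\in D}d=1$. *)

(* Defs.v *)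
From mathcomp Require Import all_boot all_fingroup.
Set Implicit Arguments.
Unset Strict Implicit.
Unset Printing Implicit Defensive.
Local Open Scope group_scope.

Definition prime_power (q : nat) : Prop :=
  exists p n : nat, [/\ prime p, (0 < n)%N & q = (p ^ n)%N].

Definition difference_set (gT : finGroupType) (G : {group gT}) (D : {set gT})
  (v k lam : nat) : Prop :=
  [/\ D \subset G, #|G| = v, #|D| = k &
      forall g, g \in G -> g != 1 ->
        #|[set x in setX D D | x.1 * x.2^-1 == g]| = lam].

(* normalized: the product of the elements of D is 1
   (order irrelevant since the ambient group is abelian) *)
Definition normalized (gT : finGroupType) (D : {set gT}) : Prop :=
  \prod_(d in D) d = 1.

(* Main.v *)
Require Import Defs.
From HB Require Import structures.
From mathcomp Require Import all_boot all_order all_fingroup all_algebra.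
From mathcomp Require Import all_solvable ring zify.
Set Implicit Arguments.
Unset Strict Implicit.
Unset Printing Implicit Defensive.
Import GRing.Theory Num.Theory Order.TTheory.

(** Write Q = q^s and q = p^f.  Since |D| - lambda = Q^2 is a power of p exceeding
    lambda, p is a multiplier, and it fixes the normalized set D.

    Let B be a subgroup of order Q + 1.  Modulo B the multiplier Q^2 is
    inversion, so D B = D^-1 B in Z[G] and (D B)^2 is a multiple of Q^2 modulo G;
    hence |D :&: gB| = 1 modulo Q for all g.  By counting, D contains exactly one
    coset uB and meets every other coset of B in a single point, and u can be
    taken in M.

    Let F be the group of fixed points of x |-> x^(q^4), a map of order dividing
    s that preserves D; it contains M.  Put R = F :&: B and E = D :&: F.  Then E
    has the same shape as D: it contains uR and meets every other coset of R in F
    in one point.  For g in F outside R this gives at least two quotient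
    representations of g by E, while fixed points modulo s give q + 1 modulo s
    of them; as s >= q there are at least q + 1.  Comparing with the |E|^2
    quotients and with |F : R| <= q^2 + 1 (this is where s does not divide
    q^2 + 1) forces equality everywhere, F = M, and the parameters.

    For the normalization, x |-> x^Q acts freely, with orbits of length 4 and
    product x^(1+Q+Q^2+Q^3) = 1, on the points x of D with x not in uB and x^2 not
    in B.  The other points of D are those of uB and points of M, and uB and uR
    have the same product. *)

(** * Divisibility in rings with a Frobenius lift *)

Section FrobeniusLift.
Local Open Scope ring_scope.

Definition ndvd (A : zmodType) (n : nat) (x : A) := exists y, x = y *+ n.

Lemma ndvdD (A : zmodType) n (x y : A) : ndvd n x -> ndvd n y -> ndvd n (x + y).
Proof. by move=> [a ->] [b ->]; exists (a + b); rewrite mulrnDl. Qed.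

Lemma ndvdN (A : zmodType) n (x : A) : ndvd n x -> ndvd n (- x).
Proof. by move=> [a ->]; exists (- a); rewrite mulNrn. Qed.

Lemma ndvdMl (A : pzRingType) n (x y : A) : ndvd n x -> ndvd n (y * x).
Proof. by move=> [a ->]; exists (y * a); rewrite mulrnAr. Qed.

Lemma ndvdMr (A : pzRingType) n (x y : A) : ndvd n x -> ndvd n (x * y).
Proof. by move=> [a ->]; exists (a * y); rewrite mulrnAl. Qed.

Lemma ndvd_sum (A : zmodType) n (I : Type) (r : seq I) (P : pred I) (F : I -> A) :
  (forall i, P i -> ndvd n (F i)) -> ndvd n (\sum_(i <- r | P i) F i).
Proof.
move=> H; elim/big_ind: _ => //; first by exists 0; rewrite mul0rn.
by move=> x y; apply: ndvdD.
Qed.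

Lemma ndvd_subC (A : zmodType) n (x y : A) : ndvd n (x - y) -> ndvd n (y - x).
Proof. by move/ndvdN; rewrite opprB. Qed.

Lemma ndvd_trans (A : zmodType) n (x y z : A) :
  ndvd n (x - y) -> ndvd n (y - z) -> ndvd n (x - z).
Proof. by move=> /ndvdD H /H; rewrite addrA subrK. Qed.

Variable (A : comNzRingType) (p : nat).
Hypothesis p_pr : prime p.

Lemma prime_exprD (a b : A) : ndvd p ((a + b) ^+ p - (a ^+ p + b ^+ p)).
Proof.
rewrite exprDn; case: p p_pr => [|n] // n_pr.
rewrite big_ord_recl big_ord_recr /= subn0 subnn !expr0.
rewrite mulr1 mul1r bin0 binn !mulr1n.
set S := \sum_(i < n) _.
have -> : a ^+ n.+1 + (S + b ^+ n.+1) - (a ^+ n.+1 + b ^+ n.+1) = S by ring.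
apply: ndvd_sum => i _.
have /dvdnP[m ->] : (n.+1 %| 'C(n.+1, bump 0 i))%N.
  by rewrite prime_dvd_bin // /bump leq0n add1n /= ltnS.
by exists (a ^+ (n.+1 - bump 0 i) * b ^+ bump 0 i *+ m); rewrite mulrnA.
Qed.

Lemma ndvd_subX n (a b : A) k : ndvd n (a - b) -> ndvd n (a ^+ k - b ^+ k).
Proof. by move=> H; rewrite subrXX; apply: ndvdMr. Qed.

(** In a^p - b^p = (a - b) * sum a^(p-1-i) b^i the sum is p * b^(p-1) modulo p, so the cofactor
    supplies one more factor p. *)
Lemma ndvd_subXp n (a b : A) :
  ndvd (p * n) (a - b) -> ndvd (p * (p * n)) (a ^+ p - b ^+ p).
Proof.
move=> [z Hz].
have [w Hw] : ndvd p (\sum_(i < p) a ^+ (p.-1 - i) * b ^+ i).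
  have -> : \sum_(i < p) a ^+ (p.-1 - i) * b ^+ i =
      \sum_(i < p) (a ^+ (p.-1 - i) - b ^+ (p.-1 - i)) * b ^+ i
      + b ^+ p.-1 *+ p.
    rewrite -[X in _ *+ X]card_ord -sumr_const -big_split /=.
    apply: eq_bigr => i _; rewrite mulrBl -exprD subnK ?subrK //.
    by rewrite -ltnS (prednK (prime_gt0 p_pr)) ltn_ord.
  apply: ndvdD; last by exists (b ^+ p.-1).
  apply: ndvd_sum => i _; apply/ndvdMr/ndvd_subX.
  by exists (z *+ n); rewrite Hz mulnC mulrnA.
exists (z * w); rewrite subrXX Hz Hw mulrnAl mulrnAr -mulrnA.
by congr (_ *+ _); rewrite mulnC.
Qed.

Lemma ndvd_subXpX (a b : A) j :
  ndvd p (a - b) -> ndvd (p ^ j.+1) (a ^+ (p ^ j) - b ^+ (p ^ j)).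
Proof.
move=> Hab; elim: j => [|j IH]; first by rewrite expn1 expn0.
by rewrite (expnSr p j) !exprM expnS expnS; apply: ndvd_subXp; rewrite -expnS.
Qed.

Variables (sigma : {rmorphism A -> A}) (m : nat).
Hypothesis sigma_frob : forall x, ndvd p (sigma x - x ^+ p).
Hypothesis p_torsion_free : forall x : A, x *+ p = 0 -> x = 0.
Hypotheses (m_gt0 : (0 < m)%N) (sigma_id : forall x, iter m sigma x = x).

Lemma ndvd_sub_expm (x : A) : ndvd p (x - x ^+ (p ^ m)).
Proof.
rewrite -[X in X - _]sigma_id; elim: (m) => [|i IH] /=.
  by rewrite subrr; exists 0; rewrite mul0rn.
apply: ndvd_trans (sigma_frob _) _.
by rewrite expnSr exprM; apply: ndvd_subX.
Qed.

Lemma torsion_freeX N (x : A) : x *+ p ^ N = 0 -> x = 0.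
Proof.
by elim: N => // N IH; rewrite expnSr mulrnA => /p_torsion_free/IH.
Qed.

Lemma torsion_free_eq N (x y : A) : x *+ p ^ N = y *+ p ^ N -> x = y.
Proof.
move=> H; apply/eqP; rewrite -subr_eq0; apply/eqP/(@torsion_freeX N).
by rewrite mulrnBl H subrr.
Qed.

(** Since X = X^(p^m) modulo p, every power of X^(p^m - 1) acts on X as an identity modulo p; the
    exponent p^N prepares the lifting to modulus p^(N+1). *)
Lemma ndvd_sub_unipotent (X : A) N :
  ndvd p (X - X * X ^+ ((p ^ m).-1 * p ^ N)).
Proof.
have Hm : (0 < p ^ m)%N by rewrite expn_gt0 prime_gt0.
elim: (p ^ N)%N => [|i IH].
  by rewrite muln0 expr0 mulr1 subrr; exists 0; rewrite mul0rn.
apply: ndvd_trans (ndvd_sub_expm X) _.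
rewrite mulnS exprD mulrA -exprS prednK //.
have -> : X ^+ (p ^ m) = X * X ^+ (p ^ m).-1 by rewrite -exprS prednK.
have -> : X * X ^+ (p ^ m).-1 - X * X ^+ (p ^ m).-1 * X ^+ ((p ^ m).-1 * i)
  = X ^+ (p ^ m).-1 * (X - X * X ^+ ((p ^ m).-1 * i)) by ring.
exact: ndvdMl.
Qed.

(** Replaces the usual argument with prime ideals above p that are stable under Frobenius. Split
    sigma X = sigma X * sigma e + sigma (X - X e): [sigma e] is a power of X modulo p^(N+1), and X -
    X e = p * X1 with X1 * Y divisible by p^N, which the induction handles. *)
Lemma ndvd_frobenius_mul N (X Y : A) :
  ndvd (p ^ N) (X * Y) -> ndvd (p ^ N) (sigma X * Y).
Proof.
elim: N X => [|N IH] X HXY; first by exists (sigma X * Y).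
have r_gt0 : (0 < (p ^ m).-1)%N.
  by rewrite -subn1 subn_gt0 -(exp1n m) ltn_exp2r // prime_gt1.
pose e := X ^+ ((p ^ m).-1 * p ^ N).
have HeY k : (0 < k)%N -> ndvd (p ^ N.+1) (X ^+ k * Y).
  by case: k => // k _; rewrite exprSr -mulrA; apply: ndvdMl.
have Hse : ndvd (p ^ N.+1) (sigma e * Y).
  pose e' := X ^+ (p * ((p ^ m).-1 * p ^ N)).
  rewrite -[sigma e](subrK e') mulrDl; apply: ndvdD; last first.
    by apply: HeY; rewrite !muln_gt0 prime_gt0 // r_gt0 expn_gt0 prime_gt0.
  (* The congruence of sigma X and X^p modulo p, raised to the power p^N, holds modulo p^(N+1). *)
  apply: ndvdMr; rewrite /e /e' rmorphXn /= (exprM X p) !exprM.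
  exact/ndvd_subXpX/ndvd_subX.
have [X1 HX1] := ndvd_sub_unipotent X N.
have [Z HZ] : ndvd (p ^ N) (sigma X1 * Y).
  apply: IH; have [W HW] : ndvd (p ^ N.+1) ((X - X * e) * Y).
    by rewrite -{1}[X]mulr1 -mulrBr mulrAC; apply: ndvdMr.
  exists W; apply: (@torsion_free_eq 1); rewrite expn1.
  by rewrite -mulrnA -expnSr -HW HX1 mulrnAl.
have -> : sigma X * Y = sigma X * (sigma e * Y) + sigma (X - X * e) * Y.
  by rewrite rmorphB rmorphM /=; ring.
apply: ndvdD; first exact: ndvdMl.
by exists Z; rewrite HX1 rmorphMn /= mulrnAl HZ -mulrnA expnSr.
Qed.

(** The quotient by p is reduced: X = X^(p^m) modulo p and p^m is at least 2, so X is divisible by p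
    as soon as its square is. Divide by p and repeat. *)
Lemma ndvd_sqr N (X : A) : ndvd (p ^ (2 * N)) (X ^+ 2) -> ndvd (p ^ N) X.
Proof.
elim: N X => [|N IH] X HX; first by exists X.
have [X1 HX1] : ndvd p X.
  rewrite -[X in ndvd _ X](subrK (X ^+ (p ^ m))); apply: ndvdD.
    exact: ndvd_sub_expm.
  have : (1 < p ^ m)%N.
    by rewrite -(exp1n m) ltn_exp2r // prime_gt1.
  move/subnK <-; rewrite exprD; apply: ndvdMl.
  have [Z ->] := HX; exists (Z *+ p ^ (2 * N).+1).
  by rewrite -mulrnA -expnSr mulnS.
have [Z HZ] : ndvd (p ^ N) X1.
  apply: IH; have [W HW] := HX; exists W; apply: (@torsion_free_eq 2).
  by rewrite -!mulrnA -!expnD addnC -mulnS -HW HX1 exprMn_n.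
by exists Z; rewrite HX1 HZ -mulrnA expnSr.
Qed.

End FrobeniusLift.

(** * The integral group ring of a finite abelian group *)

Section GroupRing.
Local Open Scope ring_scope.
Variables (T : finGroupType) (mulT_comm : commutative (@mulg T)).
Local Notation "x *g y" := (@mulg T x y) (at level 40, left associativity).

(* The commutativity proof is a parameter so that the convolution ring can be
   declared as an instance of the commutative ring structure. *)
Definition gring (cT : commutative (@mulg T)) := {ffun T -> int}.

HB.instance Definition _ := GRing.Zmodule.on (gring mulT_comm).
Local Notation ZT := (gring mulT_comm).

Definition gmul (f h : ZT) : ZT :=
  [ffun z => \sum_x f x * h (x^-1 *g z)%g].
Definition gbasis (x : T) : ZT := [ffun y => (y == x)%:R].

Lemma gmulC : commutative gmul.
Proof.
move=> f h; apply/ffunP => z; rewrite !ffunE.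
have Hinv : involutive (fun x => x^-1 *g z)%g.
  by move=> x; rewrite invMg invgK -mulgA mulT_comm mulgK.
rewrite (reindex_inj (inv_inj Hinv)) /=.
by apply: eq_bigr => x _; rewrite mulrC Hinv.
Qed.

Lemma gmulA : associative gmul.
Proof.
move=> f h k; apply/ffunP => z; rewrite !ffunE.
under eq_bigr => x _ do rewrite ffunE mulr_sumr.
under [RHS]eq_bigr => x _ do rewrite ffunE mulr_suml.
rewrite [RHS]exchange_big /=; apply: eq_bigr => x _.
rewrite [RHS](reindex_inj (mulgI x)) /=; apply: eq_bigr => y _.
by rewrite mulKg invMg mulgA mulrA.
Qed.

Lemma gmul1f : left_id (gbasis 1) gmul.
Proof.
move=> f; apply/ffunP => z; rewrite !ffunE (bigD1 1%g) //= big1 => [|x /negPf Hx].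
  by rewrite ffunE eqxx mul1r invg1 mul1g addr0.
by rewrite ffunE Hx mul0r.
Qed.

Lemma gmulDl : left_distributive gmul +%R.
Proof.
move=> f h k; apply/ffunP => z; rewrite !ffunE -big_split.
by apply: eq_bigr => x _; rewrite ffunE mulrDl.
Qed.

Lemma gbasis1_neq0 : gbasis 1 != 0.
Proof. by apply/eqP => /ffunP/(_ 1%g); rewrite !ffunE eqxx. Qed.

HB.instance Definition _ := GRing.Zmodule_isComNzRing.Build ZT
  gmulA gmulC gmul1f gmulDl gbasis1_neq0.

Lemma gmulE (f h : ZT) z : (f * h) z = \sum_x f x * h (x^-1 *g z)%g.
Proof. by rewrite ffunE. Qed.

Lemma gbasisME x (f : ZT) z : (gbasis x * f) z = f (x^-1 *g z)%g.
Proof.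
rewrite gmulE (bigD1 x) //= big1 => [|y /negPf Hy].
  by rewrite ffunE eqxx mul1r addr0.
by rewrite ffunE Hy mul0r.
Qed.

Lemma gbasisM x y : gbasis (x *g y) = gbasis x * gbasis y.
Proof.
apply/ffunP => z; rewrite gbasisME !ffunE.
by rewrite -(inj_eq (mulgI x^-1)%g) mulKg.
Qed.

Lemma gbasisX x n : gbasis (x ^+ n)%g = gbasis x ^+ n.
Proof. by elim: n => // n IH; rewrite exprS expgS gbasisM IH. Qed.

Lemma gring_sumE (I : Type) (r : seq I) (P : pred I) (F : I -> ZT) z :
  (\sum_(i <- r | P i) F i) z = \sum_(i <- r | P i) F i z.
Proof. by elim/big_rec2: _ => [|i x y _ <-]; rewrite ffunE. Qed.

Lemma gring_mulrnE (f : ZT) n z : (f *+ n) z = f z *+ n.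
Proof. by elim: n => [|n IH]; rewrite ?mulr0n ?mulrS ffunE // IH. Qed.

Lemma gring_mulrzE (f : ZT) (a : int) z : (f *~ a) z = f z * a.
Proof.
case: a => n; rewrite /intmul ?ffunE gring_mulrnE -mulr_natr ?natz //.
by rewrite NegzE mulrN.
Qed.

Lemma gring_expansion (f : ZT) : f = \sum_x gbasis x *~ f x.
Proof.
apply/ffunP => z; rewrite gring_sumE (bigD1 z) //= big1 => [|x /negPf Hx].
  by rewrite gring_mulrzE ffunE eqxx mul1r addr0.
by rewrite gring_mulrzE ffunE eq_sym Hx mul0r.
Qed.

(** The Z-linear extension of x |-> x^n, a ring endomorphism because the group is commutative; for n
    = p it is the Frobenius lift of the previous part. *)
Definition gpow (n : nat) (f : ZT) : ZT := \sum_x gbasis (x ^+ n)%g *~ f x.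

Fact gpow_zmod_morphism n : zmod_morphism (gpow n).
Proof.
move=> f h; rewrite /gpow -sumrB; apply: eq_bigr => x _.
by rewrite !ffunE mulrzBr.
Qed.
HB.instance Definition _ n := GRing.isZmodMorphism.Build ZT ZT (gpow n)
  (gpow_zmod_morphism n).

Lemma gpow_basis n x : gpow n (gbasis x) = gbasis (x ^+ n)%g.
Proof.
rewrite /gpow (bigD1 x) //= big1 => [|y /negPf Hy].
  by rewrite ffunE eqxx addr0.
by rewrite ffunE Hy.
Qed.

Fact gpow_monoid_morphism n : monoid_morphism (gpow n).
Proof.
split; first by rewrite gpow_basis expg1n.
move=> f h; rewrite {1}(gring_expansion f) {1}(gring_expansion h).
rewrite mulr_suml raddf_sum [in RHS]/gpow mulr_suml; apply: eq_bigr => x _ /=.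
rewrite !mulr_sumr raddf_sum; apply: eq_bigr => y _ /=.
rewrite !(mulrzAl, mulrzAr) !raddfMz /= -gbasisM gpow_basis expgMn ?gbasisM //.
Qed.
HB.instance Definition _ n := GRing.isMonoidMorphism.Build ZT ZT (gpow n)
  (gpow_monoid_morphism n).

Lemma iter_gpow p m f : iter m (gpow p) f = gpow (p ^ m) f.
Proof.
elim: m f => [|m IH] f.
  by rewrite /= {1}(gring_expansion f); apply: eq_bigr => x _; rewrite expg1.
rewrite iterS IH [gpow (p ^ m) f]/gpow raddf_sum; apply: eq_bigr => x _ /=.
by rewrite raddfMz /= gpow_basis -expgM expnSr.
Qed.

Lemma gpow_id m f : (forall x : T, x ^+ m = x)%g -> gpow m f = f.
Proof.
by move=> H; rewrite [RHS]gring_expansion; apply: eq_bigr => x _; rewrite H.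
Qed.

(** Modulo p both terms are additive in f, and they agree on the basis elements. *)
Lemma gpow_frobenius p (f : ZT) : prime p -> ndvd p (gpow p f - f ^+ p).
Proof.
move=> p_pr; pose h := fun f : ZT => gpow p f - f ^+ p.
have hD f1 f2 : ndvd p (h f1) -> ndvd p (h f2) -> ndvd p (h (f1 + f2)).
  move=> H1 H2; rewrite /h rmorphD.
  have -> : gpow p f1 + gpow p f2 - (f1 + f2) ^+ p = h f1 + h f2
      + ((f1 ^+ p + f2 ^+ p) - (f1 + f2) ^+ p) by rewrite /h; ring.
  by apply: ndvdD; [exact: ndvdD | apply/ndvd_subC/prime_exprD].
have h0 : ndvd p (h 0).
  by exists 0; rewrite /h rmorph0 expr0n -leqn0 leqNgt prime_gt0 // subr0 mul0rn.
have hN f1 : ndvd p (h f1) -> ndvd p (h (- f1)).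
  move=> H1; rewrite /h.
  have -> : gpow p (- f1) - (- f1) ^+ p = - h f1 - ((- f1) ^+ p + f1 ^+ p).
    by rewrite /h rmorphN; ring.
  apply: ndvdD; first exact: ndvdN.
  have := prime_exprD p_pr (- f1) f1.
  by rewrite addNr expr0n -leqn0 leqNgt prime_gt0 // sub0r.
have hMn f1 n : ndvd p (h f1) -> ndvd p (h (f1 *+ n)).
  by move=> H1; elim: n => [|n IH]; rewrite ?mulr0n ?mulrS //; apply: hD.
rewrite -/(h f) (gring_expansion f).
elim/big_rec: _ => // x f1 _; apply: hD.
have Hx : ndvd p (h (gbasis x)).
  by exists 0; rewrite /h gpow_basis gbasisX subrr mul0rn.
by case: (f x) => n; [|rewrite NegzE mulrNz; apply: hN]; apply: hMn.
Qed.

Lemma gring_torsion_free p (f : ZT) : (0 < p)%N -> f *+ p = 0 -> f = 0.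
Proof.
move=> p_gt0 /ffunP H; apply/ffunP => z; have := H z.
rewrite gring_mulrnE !ffunE => /eqP.
by rewrite mulrn_eq0 eqn0Ngt p_gt0 => /eqP.
Qed.

Lemma ndvd_gringE n (f : ZT) z : ndvd n f -> exists a : int, f z = a * n%:Z.
Proof.
by move=> [h ->]; exists (h z); rewrite gring_mulrnE -mulr_natr natz.
Qed.


End GroupRing.

(** * Multipliers and coset intersections *)

Section Correlation.
Local Open Scope group_scope.
Variable T : finGroupType.

Lemma expg_inj_coprime m : coprime m #|T| -> injective (fun x : T => x ^+ m).
Proof.
move=> co; have co' : coprime #|[set: T]%G| m by rewrite cardsT coprime_sym.
by apply: can_inj => x; apply: (expgK co'); rewrite inE.
Qed.

Lemma expg_cardT (x : T) : x ^+ #|T| = 1.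
Proof. by rewrite -cardsT expg_cardG ?inE. Qed.

(** Counts the representations of g as a quotient of elements of D, indexed by the denominator y. *)
Definition corr (D : {set T}) (g : T) : nat := #|[set y in D | g * y \in D]|.

Lemma corr1 (D : {set T}) : corr D 1 = #|D|.
Proof. by apply: eq_card => y; rewrite inE mul1g andbb. Qed.

Lemma sum_card_shift (D E : {set T}) (f : T -> T) :
  (\sum_g #|[set y in D | (g * f y)%g \in E]| = #|D| * #|E|)%N.
Proof.
under eq_bigr => g _ do rewrite -sum1_card big_mkcond.
rewrite exchange_big /=.
transitivity (\sum_(y in D) #|E|)%N; last by rewrite sum_nat_const.
rewrite [RHS]big_mkcond /=; apply: eq_bigr => y _.
under eq_bigr => g _ do rewrite inE.
case: (y \in D) => /=; last by rewrite big1.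
rewrite -sum1_card [RHS]big_mkcond (reindex_inj (mulIg (f y)^-1)) /=.
by apply: eq_bigr => g _; rewrite mulgKV.
Qed.

Lemma sum_corr (D : {set T}) : (\sum_g corr D g = #|D| * #|D|)%N.
Proof. exact: (sum_card_shift D D id). Qed.

End Correlation.

Section Multiplier.
Local Open Scope ring_scope.
Variables (T : finGroupType) (mulT_comm : commutative (@mulg T)).
Local Notation ZT := (gring mulT_comm).
Local Notation basis := (gbasis mulT_comm).

Definition gset (D : {set T}) : ZT := [ffun x => (x \in D)%:R].
Local Notation G := (gset [set: T]).
Local Notation v := #|T|.

Lemma gset_sum (D : {set T}) : gset D = \sum_(x in D) basis x.
Proof.
apply/ffunP => z; rewrite gring_sumE ffunE.
have [zD|zD] := boolP (z \in D).
  rewrite (bigD1 z) //= ffunE eqxx big1 ?addr0 // => x /andP[_ /negPf Hx].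
  by rewrite ffunE eq_sym Hx.
rewrite big1 // => x xD; rewrite ffunE; case: eqP => // E.
by rewrite E xD in zD.
Qed.

Lemma gsetME (A C : {set T}) z :
  (gset A * gset C) z = #|[set x in A | (x^-1 * z)%g \in C]|%:R.
Proof.
rewrite gmulE -sum1_card natr_sum [RHS]big_mkcond /=.
by apply: eq_bigr => x _; rewrite !ffunE inE; do 2!case: (_ \in _).
Qed.

Lemma sum_basis_mulG (D : {set T}) (f : T -> T) :
  (\sum_(x in D) basis (f x)) * G = G *+ #|D|.
Proof.
rewrite mulr_suml -sumr_const; apply: eq_bigr => x _.
by apply/ffunP => z; rewrite gbasisME !ffunE !inE.
Qed.

Lemma gset_mulG (D : {set T}) : gset D * G = G *+ #|D|.
Proof. by rewrite gset_sum (sum_basis_mulG D id). Qed.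

(** Multiplication by v - G removes multiples of G; this is how congruences modulo G are expressed
    below. *)
Lemma mulG_sub : G * (v%:R - G) = 0.
Proof. by rewrite mulrBr gset_mulG cardsT mulr_natr subrr. Qed.

Lemma gset_mulV (D : {set T}) n lam :
    #|D| = (n + lam)%N -> (forall g, g != 1%g -> corr D g = lam) ->
  gset D * gset D^-1%g = n%:R + G *+ lam.
Proof.
move=> cD cor; apply/ffunP => z; rewrite gsetME.
have -> : #|[set x in D | (x^-1 * z)%g \in D^-1%g]| = corr D z^-1%g.
  by apply: eq_card => x; rewrite !inE invMg invgK.
rewrite [RHS]ffunE !gring_mulrnE !ffunE inE.
have [->|z1] := eqVneq z 1%g; first by rewrite invg1 corr1 cD natrD.
by rewrite cor ?invg_eq1 // mul0rn add0r.
Qed.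

Lemma corr_count (D : {set T}) n lam :
    #|D| = (n + lam)%N -> (forall g, g != 1%g -> corr D g = lam) ->
  (#|D| * #|D| = n + lam * v)%N.
Proof.
move=> cD cor; rewrite -sum_corr (bigD1 1%g) //= corr1 cD.
rewrite (eq_bigr (fun=> lam)) // sum_nat_const cardC1.
have : (0 < v)%N by apply/card_gt0P; exists 1%g.
by case: v => // w _; rewrite /= mulnS mulnC; lia.
Qed.

Variables (p : nat) (p_pr : prime p) (p_coprime : coprime p v).

Lemma gpow_order : exists2 m, (0 < m)%N & forall f : ZT, iter m (gpow p) f = f.
Proof.
exists (totient v).
  by rewrite totient_gt0; apply/card_gt0P; exists 1%g.
move=> f; rewrite iter_gpow; apply: gpow_id => x.
have Ex := expg_cardT x.
rewrite (divn_eq (p ^ totient v) v) Euler_exp_totient //.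
rewrite expgD mulnC expgM Ex expg1n mul1g expg_mod // expg1 //.
Qed.

(** With n = p^N, the product D D^-1 (v - G) is n (v - G), so applying Frobenius to the factor D
    keeps divisibility by n. Hence each coefficient of D^(p) D^-1 is lam modulo n, and a coefficient
    exceeding lam is at least n + lam = |D|. *)
Lemma multiplier_theorem (D : {set T}) N lam :
    #|D| = (p ^ N + lam)%N -> (forall g, g != 1%g -> corr D g = lam) ->
    (lam < p ^ N)%N ->
  exists g, forall x, x \in D -> (g * x ^+ p)%g \in D.
Proof.
move=> cD cor lam_lt; set n := (p ^ N)%N in cD lam_lt.
have [m m_gt0 sm] := gpow_order.
pose c z := #|[set x in D | (z * x ^+ p)%g \in D]|.
have cE z : (gpow p (gset D) * gset D^-1%g) z = (c z^-1%g)%:R.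
  rewrite gset_sum rmorph_sum mulr_suml gring_sumE /c -sum1_card natr_sum.
  rewrite big_mkcond [RHS]big_mkcond /=; apply: eq_bigr => x _.
  rewrite gpow_basis gbasisME ffunE !inE invMg invgK.
  by do 2!case: (_ \in _).
have c_mod z : exists a : int, (c z * v)%:Z - (#|D| * #|D|)%:Z = a * n%:Z.
  have : ndvd n (gpow p (gset D) * (gset D^-1%g * (v%:R - G))).
    apply: (ndvd_frobenius_mul p_pr _ _ m_gt0 sm).
    - by move=> f; apply: gpow_frobenius.
    - by move=> f; apply: gring_torsion_free; apply: prime_gt0.
    rewrite mulrA (gset_mulV cD cor) mulrDl mulr_natl mulrnAl mulG_sub.
    by rewrite mul0rn addr0; exists (v%:R - G).
  move/(ndvd_gringE z^-1%g) => [a Ha]; exists a; rewrite -Ha.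
  rewrite mulrBr gset_mulG card_invg mulr_natr mulrBr !mulrnAr.
  rewrite {2}gset_sum rmorph_sum /= (eq_bigr (fun x => basis (x ^+ p)%g)).
    rewrite sum_basis_mulG !ffunE !gring_mulrnE cE invgK !ffunE inE.
    by rewrite mulr1n -!mulrnA !natz.
  by move=> x _; rewrite gpow_basis.
(* The values of c sum to |D|^2 = n + lam * v, so their average exceeds lam. *)
have c_gt : exists z, (lam < c z)%N.
  apply/existsP; apply: contraT; rewrite negb_exists => /forallP H.
  have := sum_card_shift D D (fun x => x ^+ p)%g.
  rewrite (corr_count cD cor) => E.
  have : (\sum_z c z <= \sum_(z : T) lam)%N.
    by apply: leq_sum => z _; rewrite leqNgt.
  rewrite E sum_nat_const mulnC -[X in (_ <= X)%N]add0n leq_add2r leqn0.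
  by rewrite expn_eq0 eqn0Ngt prime_gt0.
have [z cz] := c_gt; exists z => x xD.
have ncz : (n %| c z - lam)%N.
  have [a] := c_mod z; rewrite (corr_count cD cor) => Ha.
  rewrite -(@Gauss_dvdl _ _ v) ?coprimeXl //.
  suff : (n%:Z %| Posz ((c z - lam) * v))%Z by [].
  apply/dvdzP; exists (a + 1).
  rewrite mulnBl -subzn ?leq_mul2r ?(ltnW cz) ?orbT //.
  rewrite mulrDl mul1r -Ha PoszD; ring.
have Ecz : [set x in D | (z * x ^+ p)%g \in D] = D.
  apply/eqP; rewrite eqEcard; apply/andP; split.
    by apply/subsetP => y; rewrite inE => /andP[].
  rewrite -/(c z) cD addnC -leq_subRL; last exact: ltnW.
  by rewrite dvdn_leq // subn_gt0.
by move: xD; rewrite -{1}Ecz inE => /andP[].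
Qed.

(** The coefficient of X = D H at z is |D :&: zH|. As x^m is x^-1 modulo H, X = D^-1 H, so X^2 = D
    D^-1 H^2 is a multiple of p^(2N) plus a multiple of G, and [ndvd_sqr] applies to X (v - G). *)
Lemma coset_intersection_mod (D : {set T}) (H : {group T}) N m lam z :
    #|D| = (p ^ (2 * N) + lam)%N -> (forall g, g != 1%g -> corr D g = lam) ->
    coprime m v -> (forall x, x \in D -> (x ^+ m)%g \in D) ->
    (forall x : T, (x ^+ m.+1)%g \in H) ->
  (#|D :&: z *: H|%g * v = #|D| * #|H| %[mod p ^ N])%N.
Proof.
move=> cD cor co_m Dm Hm.
have [m' m'_gt0 sm] := gpow_order.
have mulHH : gset H * gset H = gset H *+ #|H|.
  apply/ffunP => y; rewrite gsetME gring_mulrnE ffunE.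
  have [yH|yH] := boolP (y \in H).
    congr (_%:R); apply: eq_card => x; rewrite inE.
    by case: (boolP (x \in H)) => //= xH; rewrite groupMr ?groupV.
  rewrite mul0rn (_ : [set x in H | _] = set0) ?cards0 //.
  apply/setP => x; rewrite !inE; case: (boolP (x \in H)) => //= xH.
  by rewrite groupMl ?groupV // (negPf yH).
have pow_inj := expg_inj_coprime co_m.
have DmE x : ((x ^+ m)%g \in D) = (x \in D).
  have ED : [set y ^+ m | y in D]%g = D.
    apply/eqP; rewrite eqEcard card_imset // leqnn andbT.
    by apply/subsetP => _ /imsetP[y yD ->]; apply: Dm.
  by rewrite -{1}ED (mem_imset _ _ pow_inj).
have invDH : gset D^-1%g * gset H = gset D * gset H.
  apply/ffunP => y; rewrite !gsetME; congr (_%:R).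
  (* The bijection f carries D to D^-1 and moves no element out of its coset of H. *)
  pose f (x : T) : T := (x ^+ m)^-1%g.
  have f_inj : injective f by move=> x1 x2 /invg_inj /pow_inj.
  rewrite -(card_preimset _ f_inj); apply: eq_card => x.
  rewrite !inE /f !invgK DmE.
  have -> : (x ^+ m * y = x ^+ m.+1 * (x^-1 * y))%g.
    by rewrite expgSr -mulgA mulKVg.
  by rewrite groupMl.
pose X := gset D * gset H.
have [W HW] : ndvd (p ^ N) (X * (v%:R - G)).
  apply: (ndvd_sqr p_pr _ _ m'_gt0 sm).
  - by move=> f; apply: gpow_frobenius.
  - by move=> f; apply: gring_torsion_free; apply: prime_gt0.
  have XX : X ^+ 2 = (p ^ (2 * N))%:R * gset H *+ #|H| + G * gset H *+ (lam * #|H|).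
    rewrite expr2 {2}/X -invDH /X mulrACA (gset_mulV cD cor) mulHH.
    by rewrite mulrDl !mulrnAr; congr (_ + _); rewrite mulrnAl -mulrnA.
  exists (gset H * (v%:R - G) ^+ 2 *+ #|H|).
  rewrite exprMn XX mulrDl [X in _ + X](_ : _ = 0) ?addr0.
    by rewrite mulr_natl !mulrnAl -!mulrnA mulnC.
  by rewrite mulrnAl (mulrC G) expr2 -mulrA (mulrA G) mulG_sub mul0r mulr0 mul0rn.
have := congr1 (fun f : ZT => f z) HW.
have XG : X * G = G *+ (#|D| * #|H|).
  by rewrite /X -mulrA gset_mulG mulrnAr gset_mulG mulrnA.
rewrite mulrBr XG mulr_natr.
have XE : X z = #|D :&: z *: H|%g%:R.
  rewrite gsetME; congr (_%:R); apply: eq_card => x.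
  by rewrite !inE mem_lcoset -groupV invMg invgK.
rewrite !ffunE !gring_mulrnE XE ffunE inE -!mulrnA -[in RHS]mulr_natr !natz => E.
apply/eqP; rewrite -eqz_nat -!modz_nat eqz_mod_dvd; apply/dvdzP.
by exists (W z); rewrite -E mul1n.
Qed.

End Multiplier.

(** * Free orbits and fixed points *)

Section Orbits.
Local Open Scope group_scope.

(** Extended by the identity outside S, f becomes a permutation of order dividing s, so its orbits
    have length 1 or s. *)
Lemma card_fix_mod (T : finType) (f : T -> T) (S : {set T}) s :
    prime s -> {in S, forall x, f x \in S} ->
    {in S, forall x, iter s f x = x} ->
  #|S| = #|[set x in S | f x == x]| %[mod s].
Proof.
move=> s_pr fS fs; pose h x := if x \in S then f x else x.
have hS i x : x \in S -> (iter i h x = iter i f x) /\ iter i f x \in S.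
  by move=> xS; elim: i => //= i [-> IH]; rewrite /h IH fS.
have hN i x : x \notin S -> iter i h x = x.
  by move=> xS; elim: i => //= i ->; rewrite /h (negPf xS).
have hs x : iter s h x = x.
  have [xS|xS] := boolP (x \in S); last exact: hN.
  by have [-> _] := hS s x xS; apply: fs.
have h_inj : injective h.
  apply: (can_inj (g := iter s.-1 h)) => x.
  by rewrite -iterSr prednK ?prime_gt0.
pose g := perm h_inj; have gX i x : (g ^+ i)%g x = iter i h x.
  by elim: i => [|i IH]; rewrite ?expg0 ?perm1 // expgSr permM IH permE.
have gs : (g ^+ s = 1)%g by apply/permP => x; rewrite gX hs perm1.
have s_g : s.-group <[g]>%g.
  rewrite /pgroup -orderE; apply: pnat_dvd (pnat_id s_pr).
  by rewrite order_dvdn gs.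
have actS : [acts <[g]>%g, on S | 'P].
  rewrite cycle_subG !inE /=; apply/subsetP => x xS.
  by rewrite inE /= apermE permE /h xS fS.
rewrite (pgroup_fix_mod s_g actS) afix_cycle; congr (_ %% _).
apply: eq_card => x; rewrite in_setI [RHS]inE; case: (boolP (x \in S)) => //= xS.
by apply/afix1P/eqP; rewrite /= apermE permE /h xS.
Qed.
End Orbits.

(** * Products over sets in a commutative group *)

Section AbelianProducts.
Local Open Scope group_scope.
Variables (T : finGroupType) (mulT_comm : commutative (@mulg T)).

(** Registers the group law as commutative, so that the general lemmas on commutative iterated
    products apply to it. *)
Let mulg_com : Monoid.com_law (1 : T) :=
  HB.pack (@mulg T) (SemiGroup.isCommutativeLaw.Build T (@mulg T) mulT_comm).
Let mulg_sgcom : SemiGroup.com_law T :=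
  HB.pack (@mulg T) (SemiGroup.isCommutativeLaw.Build T (@mulg T) mulT_comm).
Canonical mulg_com.
Canonical mulg_sgcom.

(** S splits into orbits of f of length N, each with product 1; they are removed one at a time. *)
Lemma prod_freely_permuted (f : T -> T) N (S : {set T}) : (0 < N)%N ->
    {in S, forall x, f x \in S} -> {in S, forall x, iter N f x = x} ->
    {in S, forall x, uniq (traject f x N)} ->
    {in S, forall x, \prod_(y <- traject f x N) y = 1} ->
  \prod_(x in S) x = 1.
Proof.
move=> N_gt0; have [n] := ubnP #|S|; elim: n S => // n IH S.
rewrite ltnS => Sn fS fN uS pS.
have [->|[x xS]] := set_0Vmem S; first by rewrite big_set0.
pose O := [set y in traject f x N]; pose S' := S :\: O.
have OS : O \subset S.
  apply/subsetP => y; rewrite inE => /trajectP[i _ ->].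
  by elim: i => //= i /fS.
have fO y : y \in O -> f y \in O.
  rewrite !inE => /trajectP[i iN ->]; apply/trajectP.
  move: iN; rewrite leq_eqVlt => /predU1P[E|iN]; last by exists i.+1.
  by exists 0%N; rewrite // -iterS E fN.
have pO : \prod_(y in O) y = 1.
  rewrite -[RHS](pS x xS) [RHS]big_uniq ?uS //=.
  by apply: eq_bigl => y; rewrite inE.
rewrite (big_setID O) /= (setIidPr OS) pO mul1g; apply: IH.
- apply: leq_trans Sn; apply: proper_card; apply/properP; split.
    exact: subsetDl.
  exists x => //; rewrite !inE xS andbT negbK; apply/trajectP.
  by exists 0%N.
- move=> y /setDP[yS yO]; rewrite inE fS // andbT; apply: contra yO => fyO.
  have -> : y = iter N.-1 f (f y) by rewrite -iterSr prednK // fN.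
  by elim: N.-1 => //= i /fO.
- by move=> y /setDP[yS _]; apply: fN.
- by move=> y /setDP[yS _]; apply: uS.
- by move=> y /setDP[yS _]; apply: pS.
Qed.

Lemma prodXg (S : {set T}) (F : T -> T) n :
  \prod_(x in S) F x ^+ n = (\prod_(x in S) F x) ^+ n.
Proof.
elim/big_rec2: _ => [|x a b _ ->]; first by rewrite expg1n.
by rewrite expgMn.
Qed.

Lemma prod_setID (A C : {set T}) :
  \prod_(x in A) x = \prod_(x in A :&: C) x * \prod_(x in A :\: C) x.
Proof. exact: big_setID. Qed.

Lemma prod_mull (S : {set T}) (F : T -> T) g :
  \prod_(x in S) (g * F x) = g ^+ #|S| * \prod_(x in S) F x.
Proof. by rewrite big_split /= prodg_const. Qed.

Lemma prod_imset (S : {set T}) (f : T -> T) : {in S &, injective f} ->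
  \prod_(x in f @: S) x = \prod_(x in S) f x.
Proof. exact: big_imset. Qed.

End AbelianProducts.

(** For a prime r dividing d, take H of order d / r by induction and pull back a subgroup of order r
    of G / H, given by Cauchy's theorem. *)
Lemma abelian_subgroup_of_order (gT : finGroupType) (G : {group gT}) d :
  abelian G -> d %| #|G| -> exists2 H : {group gT}, H \subset G & #|H| = d.
Proof.
move=> abG; have [n] := ubnP d; elim: n d => // n IH d; rewrite ltnS => dn dG.
have d_gt0 : 0 < d by apply: dvdn_gt0 dG.
have [d1|d1] := eqVneq d 1%N.
  by exists 1%G; rewrite ?sub1G ?cards1.
have d_gt1 : 1 < d by case: d d_gt0 d1 {dn dG} => [|[]].
have r_pr := pdiv_prime d_gt1; have rd := pdiv_dvd d; set r := pdiv d in r_pr rd.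
have dE : d = (d %/ r * r)%N by rewrite divnK.
have [H sHG cH] : exists2 H : {group gT}, H \subset G & #|H| = (d %/ r)%N.
  apply: IH.
    apply: leq_trans dn; apply: ltn_Pdiv (prime_gt1 r_pr) d_gt0.
  by apply: dvdn_trans dG; apply: dvdn_div.
have nHG : (H <| G)%g by rewrite -sub_abelian_normal.
have [|x xGH ox] := @Cauchy _ r (G / H)%G r_pr.
  rewrite card_quotient ?normal_norm // -(@dvdn_pmul2l #|H|) ?cardG_gt0 //.
  by rewrite Lagrange // cH -dE.
exists (coset H @*^-1 <[x]>)%G; first by rewrite sub_cosetpre_quo // cycle_subG.
by rewrite card_cosetpre -orderE ox cH -dE.
Qed.

(** * Factors of x^s + 1 for odd s *)

Section Arithmetic.

(** K is 1 + x^2 + ... + x^(2h-2), and x^2 = 1 modulo x + 1. *)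
Lemma odd_exp_succ_factor x h : 0 < x ->
  exists2 K, x ^ (2 * h).+1 + 1 = (x + 1) * (x * (x - 1) * K + 1)
    & K = h %[mod x + 1].
Proof.
case: x => // y _; elim: h => [|h [K EK MK]].
  by exists 0; rewrite // muln0 expn1 muln0 add0n muln1.
exists (K + y.+1 ^ (2 * h)).
  rewrite mulnS !addSn add0n; move: EK; rewrite !expnS.
  set P := y.+1 ^ _; rewrite subn1 /=; nia.
rewrite -modnDml MK modnDml -[in RHS]addn1; apply/eqP; rewrite eqn_modDl.
rewrite expnM -modnXm; have -> : y.+1 ^ 2 = y * (y.+1 + 1) + 1 by nia.
by rewrite modnMDl modnXm exp1n.
Qed.

(** Modulo x + 1 one has x (x - 1) = 2 and K = h, so the cofactor is 2h + 1 = s. *)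
Lemma odd_exp_succ_coprime x h s : 0 < x -> s = (2 * h).+1 -> prime s ->
    ~~ (s %| x + 1) ->
  exists2 K, x ^ s + 1 = (x + 1) * (x * (x - 1) * K + 1)
    & coprime (x * (x - 1) * K + 1) (x + 1).
Proof.
move=> x_gt0 sE s_pr ndvd_s; have [K EK MK] := odd_exp_succ_factor h x_gt0.
exists K; first by rewrite sE.
suff -> : coprime (x * (x - 1) * K + 1) (x + 1) = coprime s (x + 1).
  by rewrite prime_coprime.
rewrite -coprime_modl -[in RHS]coprime_modl; congr (coprime _ _).
rewrite -modnDml -modnMmr MK modnMmr modnDml sE.
case: x x_gt0 {ndvd_s EK MK} => // y _; rewrite subn1 /=.
rewrite -(modnMDl h (y.+1 * y * h + 1)).
have -> : h * (y.+1 + 1) + (y.+1 * y * h + 1) = y * h * (y.+1 + 1) + (2 * h + 1).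
  by nia.
by rewrite modnMDl addn1.
Qed.

End Arithmetic.

(** * Sets containing one coset and meeting the others once *)

Section CosetCounting.
Local Open Scope group_scope.
Variables (T : finGroupType) (F R : {group T}) (E : {set T}).
Hypotheses (sRF : R \subset F) (sEF : E \subset F).

Lemma sum_card_lcoset :
  (\sum_(z in F) #|E :&: z *: R| = #|E| * #|R|)%N.
Proof.
under eq_bigr => z _ do rewrite -sum1_card big_mkcond /=.
rewrite exchange_big /= (bigID (mem E)) /= [X in (_ + X)%N]big1; last first.
  by move=> y /negPf yE; apply: big1 => z _; rewrite inE yE.
rewrite addn0 -sum_nat_const; apply: eq_bigr => y yE.
rewrite -big_mkcondr sum1dep_card -(card_lcoset R y); apply: eq_card => z.
rewrite [LHS]inE inE yE lcoset_sym; apply/andP/idP => [[]//|zR]; split=> //.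
by have /lcosetP[r rR ->] := zR; rewrite groupM ?(subsetP sEF _ yE) ?(subsetP sRF _ rR).
Qed.

Variable u : T.
Hypotheses (uF : u \in F) (suE : u *: R \subset E).
Hypothesis E1 : {in F, forall z, z \notin u *: R -> #|E :&: z *: R| = 1%N}.

Lemma card_one_full_coset : (#|E| + 1 = #|R| + #|F : R|)%N.
Proof.
have suF : u *: R \subset F by apply: subset_trans suE sEF.
have cu z : z \in u *: R -> #|E :&: z *: R| = #|R|.
  move=> /lcoset_eqP ->; rewrite (setIidPr suE); exact: card_lcoset.
have := sum_card_lcoset; rewrite (big_setID (u *: R)) /= (setIidPr suF).
rewrite (eq_bigr (fun=> #|R|)) // sum_nat_const card_lcoset.
rewrite (eq_bigr (fun=> 1%N)); last by move=> z /setDP[]; apply: E1.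
rewrite sum1_card cardsD (setIidPr suF) card_lcoset -(Lagrange sRF).
have := cardG_gt0 R; have : (0 < #|F : R|)%N by rewrite indexg_gt0.
set r := #|R|; set t := #|F : R|; nia.
Qed.

Lemma sum_corr_in : (\sum_(g in F) corr E g = #|E| * #|E|)%N.
Proof.
rewrite -sum_corr [RHS](bigID (mem F)) /= [X in (_ + X)%N]big1 ?addn0 // => g gF.
apply: eq_card0 => y; rewrite inE; apply/andP => -[/(subsetP sEF) yF].
by move/(subsetP sEF); rewrite groupMr // (negPf gF).
Qed.

Hypothesis mulT_comm : commutative (@mulg T).

Lemma one_full_coset_eq x y :
  x \in E -> y \in E -> x^-1 * y \in R -> x \notin u *: R -> x = y.
Proof.
move=> xE yE xyR xu; have /eqP/cards1P[z Ez] := E1 (subsetP sEF x xE) xu.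
have : x \in E :&: x *: R by rewrite inE xE lcoset_refl.
have : y \in E :&: x *: R by rewrite inE yE mem_lcoset.
by rewrite !Ez !inE => /eqP-> /eqP->.
Qed.

(** The distinct points y and g y lie in the same coset of R, which must then be the full coset
    uR. *)
Lemma corr_subgroup g : g \in R -> g != 1 -> corr E g = #|R|.
Proof.
move=> gR g1; rewrite /corr -(card_lcoset R u); apply: eq_card => y.
rewrite inE; apply/andP/idP => [[yE gyE]|yu].
  apply: contraR g1 => yu; have /esym/eqP : y = g * y.
    by apply: one_full_coset_eq => //; rewrite mulT_comm mulgK.
  by rewrite eq_mulgV1 mulgK.
split; apply: (subsetP suE) => //.
by rewrite mulT_comm mem_lcoset mulgA groupM // -mem_lcoset.
Qed.

(** One representation has its denominator in uR and its numerator e in guR; the other has its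
    numerator in uR and its denominator e' in g^-1 uR. If they coincided, e and g^-1 e would both
    lie in uR, putting g in R. *)
Lemma corr_ge2 g : g \in F -> g \notin R -> 1 < corr E g.
Proof.
move=> gF gR.
have pt z : z \in F -> z \notin u *: R ->
    exists2 e, e \in E & z^-1 * e \in R.
  move=> zF zu; have /eqP/cards1P[e Ee] := E1 zF zu.
  have : e \in E :&: z *: R by rewrite Ee inE.
  by rewrite inE mem_lcoset => /andP[]; exists e.
have notin h : h \notin R -> h * u \notin u *: R.
  by rewrite mem_lcoset mulT_comm mulgK.
have [e eE eR] : exists2 e, e \in E & (g * u)^-1 * e \in R.
  by apply: pt; rewrite ?groupM ?notin.
have [e' e'E e'R] : exists2 e, e \in E & (g^-1 * u)^-1 * e \in R.
  by apply: pt; rewrite ?groupM ?groupV ?notin ?groupV.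
have geu : g^-1 * e \in u *: R by rewrite mem_lcoset mulgA -invMg.
have geu' : g * e' \in u *: R.
  by move: e'R; rewrite mem_lcoset invMg invgK mulgA (mulT_comm u^-1).
rewrite /corr (cardD1 (g^-1 * e)) (cardD1 e') !inE mulKVg eE e'E.
rewrite !(subsetP suE _ geu) (subsetP suE _ geu') /=.
suff -> : e' != g^-1 * e by [].
apply: contra gR => /eqP Ee; rewrite Ee mulKVg in geu'.
rewrite Ee in e'R.
have eu : u^-1 * e \in R by rewrite -mem_lcoset.
have geR : u^-1 * (g^-1 * e) \in R by rewrite -mem_lcoset.
have -> : g = (u^-1 * e) * (u^-1 * (g^-1 * e))^-1.
  by rewrite !invMg !invgK !mulgA mulgK -mulgA mulT_comm mulgK.
by rewrite groupM ?groupV.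
Qed.

End CosetCounting.

(** * The multiplier p and the full coset *)

Section DifferenceSetStructure.
Local Open Scope group_scope.
Variables (T : finGroupType) (mulT_comm : commutative (@mulg T)).
Variable D : {set T}.

Lemma mem_expg_coprime (H : {group T}) m x :
  coprime m #|T| -> (x ^+ m \in H) = (x \in H).
Proof.
move=> co; have co' : coprime #|[set: T]%G| m by rewrite cardsT coprime_sym.
apply/idP/idP => [xmH|/groupX-> //].
by rewrite -(expgK co' (in_setT x)) groupX.
Qed.

Lemma expg_index (H : {group T}) x : x ^+ #|[set: T] : H| \in H.
Proof.
have nH : H <| [set: T].
  rewrite -sub_abelian_normal ?subsetT //.
  by apply/centsP => a _ b _; apply: mulT_comm.
have xN : x \in 'N(H) by rewrite (subsetP (normal_norm nH)) ?inE.
apply: coset_idr; first exact: groupX.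
rewrite morphX // -card_quotient ?normal_norm //; apply: expg_cardG.
by apply: mem_quotient; rewrite inE.
Qed.

(** The translate in gD^(p) = D is trivial: comparing products gives g^|D| = 1, and |D| is coprime
    to the group order. *)
Lemma normalized_multiplier p N lam :
    prime p -> coprime p #|T| -> #|D| = (p ^ N + lam)%N ->
    (forall g, g != 1 -> corr D g = lam) -> (lam < p ^ N)%N ->
    coprime #|D| #|T| -> \prod_(x in D) x = 1 ->
  forall x, x \in D -> x ^+ p \in D.
Proof.
move=> p_pr co_p cD cor lam_lt co_D nD.
have [g gD] := multiplier_theorem mulT_comm p_pr co_p cD cor lam_lt.
pose h x := g * x ^+ p.
have h_inj : injective h by move=> x y /mulgI/(expg_inj_coprime co_p).
have hD : h @: D = D.
  apply/eqP; rewrite eqEcard card_imset // leqnn andbT.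
  by apply/subsetP => _ /imsetP[x xD ->]; apply: gD.
have : \prod_(x in h @: D) x = 1 by rewrite hD.
rewrite prod_imset //; last by move=> x y _ _; apply: h_inj.
rewrite prod_mull // prodXg // nD expg1n mulg1 => gk x xD.
have g1 : g = 1.
  by apply: (expg_inj_coprime co_D); rewrite /= gk expg1n.
by have := gD x xD; rewrite g1 mul1g.
Qed.

(** Modulo B the multiplier Q^2 is inversion, so each coset of B meets D in 1 modulo Q points, that
    is in 1 or Q + 1. Counting D over the cosets leaves exactly one full coset. *)
Lemma unique_full_coset p N (B : {group T}) :
  let Q := (p ^ N)%N in
    prime p -> (1 < Q)%N ->
    #|T| = ((Q + 1) * (Q ^ 2 + 1))%N -> #|D| = (Q ^ 2 + Q + 1)%N ->
    (forall g, g != 1 -> corr D g = (Q + 1)%N) ->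
    {in D, forall x, x ^+ (Q ^ 2) \in D} -> #|B| = (Q + 1)%N ->
  exists2 u, u *: B \subset D &
    forall z, z \notin u *: B -> #|D :&: z *: B| = 1%N.
Proof.
move=> Q p_pr Q_gt1 cT cD cor DQ cB.
have ET : #|T| = ((Q ^ 2 + Q + 1) * Q + 1)%N by rewrite cT; ring.
have co_Q : coprime Q #|T| by rewrite ET -coprime_modr modnMDl coprime_modr coprimen1.
have co_p : coprime p #|T|.
  by rewrite -(@coprime_pexpl N) // lt0n; apply: contraTneq Q_gt1 => N0; rewrite /Q N0.
have iB : #|[set: T] : B| = (Q ^ 2).+1.
  apply/eqP; rewrite -(eqn_pmul2l (cardG_gt0 B)) Lagrange ?subsetT // cB.
  by rewrite cardsT cT !addn1.
have Bm x : x ^+ (Q ^ 2).+1 \in B by rewrite -iB expg_index.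
have cDz z : #|D :&: z *: B| = 1%N \/ #|D :&: z *: B| = #|B|.
  have cD' : #|D| = (p ^ (2 * N) + (Q + 1))%N by rewrite cD mulnC expnM addnA.
  have co_Q2 : coprime (Q ^ 2) #|T| by rewrite coprimeXl.
  have := coset_intersection_mod mulT_comm p_pr co_p z cD' cor co_Q2 DQ Bm.
  have bB : #|D :&: z *: B| <= #|B|.
    by rewrite -(card_lcoset B z) subset_leq_card // subsetIr.
  rewrite -/Q cB in bB *; move: bB; set b := #|_ :&: _| => bB.
  rewrite cD ET mulnDr muln1 mulnA modnMDl.
  have -> : ((Q ^ 2 + Q + 1) * (Q + 1) = (Q ^ 2 + 2 * Q + 2) * Q + 1)%N by ring.
  rewrite modnMDl (modn_small Q_gt1) => b1.
  have := divn_eq b Q; rewrite b1; move: (b %/ Q) => k Eb.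
  case: k Eb => [|k] Eb; [left | right]; first by rewrite Eb.
  by case: k Eb => [|k] Eb; [rewrite Eb mul1n | move: Eb bB Q_gt1; clearbody Q; nia].
pose U := [set z | z *: B \subset D].
have cU : #|U| = #|B|.
  have := sum_card_lcoset (subsetT B) (subsetT D).
  rewrite (big_setID U) /= setTI.
  rewrite (eq_bigr (fun=> #|B|)); last first.
    by move=> z; rewrite inE => /setIidPr ->; rewrite card_lcoset.
  rewrite [X in (_ + X)%N](eq_bigr (fun=> 1%N)); last first.
    move=> z; rewrite !inE andbT => zU; have [//|E] := cDz z.
    case/negP: zU; apply/setIidPr/eqP; rewrite eqEcard subsetIr E.
    by rewrite card_lcoset leqnn.
  rewrite sum_nat_const sum1_card cardsD setTI cardsT cT cD cB.
  have : #|U| <= #|T| by apply: max_card.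
  rewrite cT; move: #|U| Q_gt1; clearbody Q => k; nia.
have [u uU] : exists u, u \in U.
  by apply/set0Pn; rewrite -cards_eq0 cU -lt0n cardG_gt0.
have EU : u *: B = U.
  apply/eqP; rewrite eqEcard card_lcoset cU leqnn andbT.
  apply/subsetP => z /lcoset_eqP Ez; rewrite inE Ez.
  by move: uU; rewrite inE.
exists u; first by move: uU; rewrite inE.
move=> z; rewrite EU inE => zU; have [//|E] := cDz z.
case/negP: zU; apply/setIidPr/eqP; rewrite eqEcard subsetIr E.
by rewrite card_lcoset leqnn.
Qed.

End DifferenceSetStructure.

(** * The theorem for a commutative group type *)

Lemma odd_q_qpred q k : odd (q * (q - 1) * k + 1).
Proof.
rewrite addn1 /= oddM; suff -> : odd (q * (q - 1)) = false by [].
by case: q => // n; rewrite subn1 oddM /=; case: (odd n).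
Qed.

Lemma exp4_pred q : q ^ 4 - 1 = (q ^ 2 - 1) * (q ^ 2 + 1).
Proof. by rewrite -subn_sqr -expnM exp1n. Qed.

(** Both cofactors have the form x (x - 1) K + 1, with x = q for c and x = q^2 for e. The product c
    e will be the index of M, and the coprimality of e, where s not dividing q^2 + 1 enters, will
    bound the index of R in F. *)
Lemma index_factorization q s : 1 < q -> prime s -> odd s ->
    ~~ (s %| q ^ 2 + 1) ->
  exists c e j, [/\ q ^ s + 1 = (q + 1) * c,
    (q ^ s) ^ 2 + 1 = (q ^ 2 + 1) * e, c * e = (q - 1) * j + 1,
    odd (c * e) & coprime e (q ^ 4 - 1)].
Proof.
move=> q_gt1 s_pr s_odd s_ndvd.
have sE : s = (2 * s./2).+1 by rewrite mul2n -{1}(odd_double_half s) s_odd.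
have [K1 E1 _] := odd_exp_succ_factor s./2 (ltnW q_gt1).
have x_gt0 : 0 < q ^ 2 by rewrite expn_gt0 ltnW.
have [K2 E2 co2] := odd_exp_succ_coprime x_gt0 sE s_pr s_ndvd.
rewrite -sE in E1; rewrite -expnM mulnC expnM.
exists (q * (q - 1) * K1 + 1), (q ^ 2 * (q ^ 2 - 1) * K2 + 1).
have xE : q ^ 2 - 1 = (q - 1) * (q + 1) by rewrite -subn_sqr exp1n.
exists (q * K1 + q ^ 2 * (q + 1) * K2 + q * K1 * (q ^ 2 * (q ^ 2 - 1) * K2)).
split=> //.
- by rewrite xE; ring.
- by rewrite oddM !odd_q_qpred.
rewrite exp4_pred coprimeMr co2 andbT.
by rewrite mulnAC -coprime_modl modnMDl coprime_modl coprime1n.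
Qed.

Lemma sum_eq_lower_bound (I : finType) (A : {set I}) (F : I -> nat) m :
    {in A, forall i, m <= F i} -> \sum_(i in A) F i = #|A| * m ->
  {in A, forall i, F i = m}.
Proof.
move=> Fm; rewrite -sum_nat_const => S i iA; apply/eqP; rewrite eqn_leq Fm // andbT.
have := leq_sum (P := fun j => (j \in A) && (j != i)) (E1 := fun=> m) (E2 := F)
  (index_enum I).
move=> le; move: S; rewrite (bigD1 i) //= [RHS](bigD1 i) //= => S.
rewrite -(leq_add2r (\sum_(j in A | j != i) F j)) S leq_add2l.
by apply: le => j /andP[/Fm].
Qed.

(** To be read with n = |E|, r = |R|, a = |F : R| - 1 and S the number of quotient representations
    of elements of F outside R. *)
Lemma extremal_counting n r a S q :
    1 < q -> 0 < a -> n = r + a -> n + (r - 1) * r + S = n * n ->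
    r * a * (q + 1) <= S -> (q + 1) * (q ^ 2 + 1) <= r * (a + 1) -> a <= q ^ 2 ->
  [/\ r = q + 1, a = q ^ 2 & S = r * a * (q + 1)].
Proof.
move=> q_gt1 a_gt0 -> sumE leS FM a_le.
have r_gt0 : 0 < r.
  by rewrite lt0n; apply: contraTneq FM => ->; rewrite mul0n leqn0 muln_eq0 !addn1.
have SE : S = a * (2 * r + a - 1) by nia.
(* Comparing S = a (2r + a - 1) with its lower bound gives r (q - 1) <= a - 1 <= q^2 - 1, hence r <=
   q + 1; the lower bound on r (a + 1) then forces equality. *)
have le1 : r * (q + 1) <= 2 * r + a - 1.
  by rewrite -(leq_pmul2l a_gt0) -SE; apply: leq_trans leS; rewrite mulnA (mulnC a).
have r_le : r <= q + 1.
  rewrite -(leq_pmul2r (_ : 0 < q - 1)) ?subn_gt0 //.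
  have -> : (q + 1) * (q - 1) = q ^ 2 - 1 by rewrite mulnC -subn_sqr exp1n.
  by move: q_gt1 le1 a_le; clear; nia.
have rE : r = q + 1.
  apply/eqP; rewrite eqn_leq r_le /= leqNgt; apply/negP => r_lt.
  have r_le' : r <= q by rewrite addn1 ltnS in r_lt.
  have a1 : a + 1 <= q ^ 2 + 1 by rewrite leq_add2r.
  have := leq_trans FM (leq_mul r_le' a1).
  by rewrite leqNgt ltn_pmul2r ?addn1 // ltnSn.
have aE : a = q ^ 2.
  apply/eqP; rewrite eqn_leq a_le /=.
  by move: FM; rewrite rE leq_pmul2l ?addn1.
split=> //; rewrite SE rE aE.
case: q q_gt1 {FM leS r_le le1 rE aE a_le SE sumE} => // y _.
have -> : 2 * (y.+1 + 1) + y.+1 ^ 2 = (y.+1 + 1) ^ 2 + 1 by ring.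
rewrite addnK; ring.
Qed.

Section CommutativeCase.
Local Open Scope group_scope.
Variables (T : finGroupType) (mulT_comm : commutative (@mulg T)).
Variables (D : {set T}) (M : {group T}) (p f q s : nat).
Hypotheses (p_pr : prime p) (qE : q = (p ^ f)%N) (q_gt1 : (1 < q)%N).
Hypotheses (s_pr : prime s) (s_odd : odd s) (q_le_s : (q <= s)%N).
Hypothesis s_ndvd : ~~ (s %| q ^ 2 + 1)%N.
Let Q := (q ^ s)%N.
Hypothesis cT : #|T| = ((Q + 1) * (Q ^ 2 + 1))%N.
Hypothesis cD : #|D| = (Q ^ 2 + Q + 1)%N.
Hypothesis corD : forall g, g != 1 -> corr D g = (Q + 1)%N.
Hypothesis prodD : \prod_(x in D) x = 1.
Hypothesis cM : #|M| = ((q + 1) * (q ^ 2 + 1))%N.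

Let QE : Q = (p ^ (f * s))%N. Proof. by rewrite /Q qE -expnM. Qed.

Let Q_gt1 : (1 < Q)%N.
Proof. by rewrite /Q -(exp1n s) ltn_exp2r // prime_gt0. Qed.

Let cTE : #|T| = ((Q ^ 2 + Q + 1) * Q + 1)%N.
Proof. by rewrite cT; ring. Qed.

Let co_Q : coprime Q #|T|.
Proof. by rewrite cTE -coprime_modr modnMDl coprime_modr coprimen1. Qed.

Let co_p : coprime p #|T|.
Proof.
rewrite -(@coprime_pexpl (f * s)) -?QE // lt0n; apply: contraTneq Q_gt1 => E.
by rewrite QE E.
Qed.

Lemma mem_expq i x : x \in D -> x ^+ (q ^ i) \in D.
Proof.
have co_D : coprime #|D| #|T|.
  by rewrite cTE -cD -coprime_modr mulnC modnMDl coprime_modr coprimen1.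
have cD' : #|D| = (p ^ (f * s * 2) + (Q + 1))%N.
  by rewrite cD expnM -QE addnA.
have lam_lt : (Q + 1 < p ^ (f * s * 2))%N.
  by rewrite expnM -QE; move: Q_gt1; clear; nia.
have Dp := normalized_multiplier mulT_comm p_pr co_p cD' corD lam_lt co_D prodD.
rewrite qE -expnM; elim: (f * i)%N x => [|k IH] x xD; first by rewrite expn0 expg1.
by rewrite expnSr expgM; apply/Dp/IH.
Qed.

Let expQ4 (x : T) : x ^+ (Q ^ 4) = x.
Proof.
have -> : (Q ^ 4 = #|T| * (Q - 1) + 1)%N.
  rewrite cT; case: Q Q_gt1 => // n _; rewrite subn1 /=; ring.
by rewrite expgD expgM expg_cardT expg1n mul1g expg1.
Qed.

Lemma iter_expg m i (x : T) : iter i (fun y => y ^+ m) x = x ^+ (m ^ i).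
Proof. by elim: i => [|i IH] /=; rewrite ?expg1 // IH -expgM expnSr. Qed.

Variables (c e j : nat).
Hypotheses (cE : (Q + 1 = (q + 1) * c)%N) (eE : (Q ^ 2 + 1 = (q ^ 2 + 1) * e)%N).
Hypotheses (ceE : (c * e = (q - 1) * j + 1)%N) (odd_ce : odd (c * e)).
Hypothesis co_e : coprime e (q ^ 4 - 1).

Variables (B : {group T}) (u : T).
Hypothesis cB : #|B| = (Q + 1)%N.
Hypothesis suD : u *: B \subset D.
Hypothesis D1 : forall z, z \notin u *: B -> #|D :&: z *: B| = 1%N.

Lemma index_M : #|[set: T] : M| = (c * e)%N.
Proof.
apply/eqP; rewrite -(eqn_pmul2l (cardG_gt0 M)) Lagrange ?subsetT //.
by rewrite cardsT cT cE eE cM mulnACA.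
Qed.

(** The map x |-> x^q sends the Q + 1 points of uB injectively into D and into the coset of u^q,
    while a coset other than uB has a single point of D. *)
Lemma full_coset_expq : u ^+ (q - 1) \in B.
Proof.
have uqE : u^-1 * u ^+ q = u ^+ (q - 1).
  by rewrite subn1 -{1}(prednK (ltnW q_gt1)) expgS mulKg.
rewrite -uqE -mem_lcoset; apply: contraT => /D1 E.
have co_q : coprime q #|T|.
  by rewrite -(@coprime_pexpl s) ?prime_gt0.
have sub : [set x ^+ q | x in u *: B] \subset D :&: u ^+ q *: B.
  apply/subsetP => _ /imsetP[_ /lcosetP[b bB ->] ->]; rewrite inE.
  rewrite -(expn1 q) mem_expq ?(subsetP suD) ?mem_lcoset ?mulKg //=.
  by rewrite expn1 expgMn // mulKg groupX.
have := subset_leq_card sub; rewrite E card_imset; last exact: expg_inj_coprime.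
by rewrite card_lcoset cB addn1 ltnS leqn0 eqn0Ngt ltnW.
Qed.

Lemma full_coset_expg m k : (m = (q - 1) * k + 1)%N -> u ^+ m \in u *: B.
Proof.
move=> ->; rewrite mem_lcoset expgD expgM expg1 mulT_comm mulgK.
exact/groupX/full_coset_expq.
Qed.

Hypothesis uM : u \in M.
Variable F : {group T}.
Hypothesis FE : forall x, (x \in F) = (x ^+ (q ^ 4) == x).

Lemma expg_pred_eq1 m (x : T) : (0 < m)%N -> (x ^+ m == x) = (x ^+ (m - 1) == 1).
Proof.
move=> m_gt0; rewrite -{1}(subnK m_gt0) addn1 expgSr -[X in _ == X]mul1g.
by rewrite (inj_eq (mulIg x)).
Qed.

Lemma q4_gt0 : (0 < q ^ 4)%N. Proof. by rewrite expn_gt0 ltnW. Qed.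

Lemma M_sub_F : M \subset F.
Proof.
apply/subsetP => x xM; rewrite FE expg_pred_eq1 ?q4_gt0 //.
have -> : (q ^ 4 - 1 = #|M| * (q - 1))%N.
  by rewrite cM mulnC mulnA -subn_sqr exp1n exp4_pred.
by rewrite expgM expg_cardG // expg1n.
Qed.

(** The power map x |-> x^(q^4) preserves both D and zB, hence fixes their only common point. *)
Lemma mem_F_of_coset z d :
  z \in F -> z \notin u *: B -> d \in D -> d \in z *: B -> d \in F.
Proof.
move=> zF zu dD dz; rewrite FE; have /eqP/cards1P[x Ex] := D1 zu.
have : d \in D :&: z *: B by rewrite inE dD.
have : d ^+ (q ^ 4) \in D :&: z *: B.
  rewrite inE mem_expq //; have /lcosetP[b bB ->] := dz.
  have := zF; rewrite FE => /eqP zq.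
  by rewrite expgMn // zq mem_lcoset mulKg groupX.
by rewrite !Ex !inE => /eqP-> /eqP->.
Qed.

(** * Counting quotients in [D :&: F] *)

Let R := (F :&: B)%G.
Let E := D :&: F.
Let uF : u \in F. Proof. exact: (subsetP M_sub_F). Qed.
Let sRF : R \subset F. Proof. exact: subsetIl. Qed.
Let sEF : E \subset F. Proof. exact: subsetIr. Qed.

Lemma mem_lcoset_R x y : x \in F -> y \in F -> (x \in y *: R) = (x \in y *: B).
Proof. by move=> xF yF; rewrite !mem_lcoset inE groupM ?groupV. Qed.

Let suE : u *: R \subset E.
Proof.
apply/subsetP => _ /lcosetP[b /setIP[bF bB] ->].
by rewrite inE groupM ?uF // andbT (subsetP suD) // mem_lcoset mulKg.
Qed.

Let E1 : {in F, forall z, z \notin u *: R -> #|E :&: z *: R| = 1%N}.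
Proof.
move=> z zF; rewrite mem_lcoset_R ?uF // => zu; rewrite -(D1 zu).
apply: eq_card => d; rewrite !inE -andbA; case: (boolP (d \in D)) => //= dD.
have [dF|dF] := boolP (d \in F); first by rewrite mem_lcoset_R.
by apply/esym/negP => dz; case/negP: dF; apply: mem_F_of_coset dz.
Qed.

Let expT_mod : ((q ^ 4) ^ s = Q ^ 4)%N.
Proof. by rewrite -!expnM mulnC. Qed.

(** Among the q^s + 1 representations of g by D, those by E are the fixed points of y |-> y^(q^4),
    whose s-th iterate is y |-> y^(Q^4), the identity. Fermat gives q^s = q modulo s. *)
Lemma corr_mod g : g \in F -> g != 1 -> (corr E g = q + 1 %[mod s])%N.
Proof.
move=> gF g1; pose S := [set y in D | g * y \in D].
have gq : g ^+ (q ^ 4) = g by apply/eqP; rewrite -FE.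
have -> : corr E g = #|[set y in S | y ^+ (q ^ 4) == y]|.
  apply: eq_card => y; rewrite !inE -FE (groupMl _ gF).
  by case: (y \in D); case: (y \in F); rewrite ?andbT ?andbF.
rewrite -(@card_fix_mod _ (fun y => y ^+ (q ^ 4)) S s s_pr) //.
- have -> : #|S| = (q ^ s + 1)%N by apply: corD.
  by rewrite -modnDml fermat_little // modnDml.
- move=> y; rewrite !inE => /andP[yD gyD].
  by rewrite mem_expq // -{1}gq -expgMn // mem_expq.
by move=> y _; rewrite iter_expg expT_mod expQ4.
Qed.

(** Otherwise s would divide q + 1 - [corr E g], which is positive and, by [corr_ge2], at most q - 1
    < s. *)
Lemma corr_ge g : g \in F -> g \notin B -> (q + 1 <= corr E g)%N.
Proof.
move=> gF gB; have g1 : g != 1 by apply: contraNneq gB => ->; apply: group1.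
have := corr_ge2 uF suE E1 mulT_comm gF.
rewrite inE gF gB => /(_ isT) ge2; rewrite leqNgt; apply/negP => lt.
have : (s %| q + 1 - corr E g)%N.
  by rewrite -eqn_mod_dvd ?(ltnW lt) //; apply/eqP/esym/corr_mod.
move/dvdn_leq; rewrite subn_gt0 lt => /(_ isT).
by move: (corr E g) ge2 lt q_le_s; clear; lia.
Qed.

(** Otherwise |M| divides Q + 1, so q^2 + 1 divides both Q + 1 and Q^2 + 1, and therefore 2. *)
Lemma F_not_sub_B : ~~ (F \subset B).
Proof.
apply/negP => /(subset_trans M_sub_F)/cardSg; rewrite cM cB => dvd1.
have {}dvd1 : (q ^ 2 + 1 %| Q + 1)%N by apply: dvdn_trans dvd1; apply: dvdn_mull.
have dvd2 : (q ^ 2 + 1 %| Q ^ 2 + 1)%N by rewrite eE dvdn_mulr.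
have : (q ^ 2 + 1 %| Q ^ 2 + 1 - (Q + 1) * (Q - 1))%N.
  by rewrite dvdn_sub // dvdn_mulr.
have -> : (Q ^ 2 + 1 - (Q + 1) * (Q - 1) = 2)%N.
  have Q2_gt0 : (0 < Q ^ 2)%N by rewrite sqrn_gt0 ltnW.
  rewrite mulnC -subn_sqr exp1n subnBA //.
  by rewrite -addnA addKn.
by move/dvdn_leq => /(_ isT); move: q_gt1; clear; nia.
Qed.

(** The index is that of B in FB, so it divides Q^2 + 1 = (q^2 + 1) e. A prime dividing |F| is the
    order of an element killed by q^4 - 1, so |F| is coprime to e. *)
Lemma index_R_dvd : (#|F : R| %| q ^ 2 + 1)%N.
Proof.
have co : coprime #|F| e.
  apply: contraT; rewrite /coprime => gcd1.
  have g_gt1 : (1 < gcdn #|F| e)%N.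
    by rewrite ltn_neqAle eq_sym gcd1 gcdn_gt0 cardG_gt0.
  have r_pr := pdiv_prime g_gt1; have := pdiv_dvd (gcdn #|F| e).
  rewrite dvdn_gcd => /andP[rF re].
  have [x xF ox] := Cauchy r_pr rF.
  have : (pdiv (gcdn #|F| e) %| gcdn e (q ^ 4 - 1))%N.
    rewrite dvdn_gcd re -ox order_dvdn -expg_pred_eq1 ?q4_gt0 // -FE xF //.
  by rewrite (eqP co_e) dvdn1 => /eqP r1; rewrite r1 in r_pr.
rewrite -(@Gauss_dvdl _ _ e); last first.
  by apply: coprime_dvdl co; apply: dvdn_indexg.
rewrite -eE -(@dvdn_pmul2l #|B|) ?cardG_gt0 //.
have -> : (#|B| * #|F : R| = #|F <*> B|)%N.
  apply/eqP; rewrite -(eqn_pmul2r (cardG_gt0 R)) -mulnA (mulnC #|F : R|) Lagrange //.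
  rewrite mulnC mul_cardG cent_joinEr //.
  by apply/centsP => x _ y _; apply: mulT_comm.
by rewrite cB -cT -cardsT cardSg ?subsetT.
Qed.

(** The |E|^2 quotients split into those equal to 1, those in R, counted exactly, and those outside
    R, each value occurring at least q + 1 times. The extremal count makes all these bounds
    equalities. *)
Lemma sub_difference_set :
  [/\ #|R| = (q + 1)%N, F :=: M, #|E| = (q ^ 2 + q + 1)%N
    & forall g, g \in M -> g != 1 -> corr E g = (q + 1)%N].
Proof.
have t_gt1 : (1 < #|F : R|)%N.
  by rewrite indexg_gt1 subsetI subxx F_not_sub_B.
have t_le : (#|F : R| <= q ^ 2 + 1)%N.
  by apply: dvdn_leq index_R_dvd; rewrite addn1.
have cE1 := card_one_full_coset sRF sEF uF suE E1.
have FM : (#|M| <= #|F|)%N := subset_leq_card M_sub_F.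
have sumE := sum_corr_in sEF.
have cFR : #|F :\: R| = (#|R| * (#|F : R| - 1))%N.
  by rewrite cardsD (setIidPr sRF) mulnBr muln1 Lagrange.
have sumR : (\sum_(g in R) corr E g = #|E| + (#|R| - 1) * #|R|)%N.
  rewrite (bigD1 1) ?group1 //= corr1; congr (_ + _)%N.
  have -> : (#|R| - 1 = #|R :\ 1%g|)%N by rewrite (cardsD1 1%g R) group1 addKn.
  rewrite -sum_nat_const; apply: eq_big => g; first by rewrite !inE andbC.
  by move=> /andP[gR g1]; apply: (corr_subgroup sEF suE E1 mulT_comm).
have geFR : {in F :\: R, forall g, (q + 1 <= corr E g)%N}.
  move=> g /setDP[gF gR]; apply: corr_ge => //.
  by apply: contra gR => gB; rewrite inE gF.
have := leq_sum (P := mem (F :\: R)) (E1 := fun=> (q + 1)%N) (index_enum T) geFR.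
move: sumE; rewrite (big_setID R) /= (setIidPr sRF) sumR sum_nat_const cFR.
set S := (\sum_(g in F :\: R) _)%N => sumE leS.
have rt := Lagrange sRF; rewrite -rt cM in FM.
have [rE tE SE] : [/\ #|R| = (q + 1)%N, #|F : R| = (q ^ 2 + 1)%N
    & S = (#|F :\: R| * (q + 1))%N].
  rewrite cFR; move: cE1 sumE leS FM t_gt1 t_le q_gt1.
  move: #|E| #|R| #|F : R| S; clear.
  (* The index is at least 2 and is written [a.+2], so [a.+1] takes the place of a in
     [extremal_counting]. *)
  move=> n r [|[|a]] // S nE sumE leS FM _ a_le q_gt1.
  rewrite subn1 /= in leS *.
  have nE' : n = (r + a.+1)%N by move: nE; clear; lia.
  have a_le' : (a.+1 <= q ^ 2)%N by rewrite addn1 ltnS in a_le.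
  rewrite -(addn1 a.+1) in FM *.
  by have [] // := extremal_counting q_gt1 _ nE' sumE leS FM a_le'; move=> -> -> ->.
have FME : F :=: M.
  apply/eqP; rewrite eq_sym eqEcard M_sub_F -rt rE tE cM leqnn //.
split=> //; first by apply/eqP; rewrite -(eqn_add2r 1) cE1 rE tE; apply/eqP; ring.
move=> g gM g1; rewrite -FME in gM; have [gR|gR] := boolP (g \in R).
  by rewrite (corr_subgroup sEF suE E1 mulT_comm).
by apply: (sum_eq_lower_bound geFR SE); rewrite inE gR.
Qed.

(** * The product over [D :&: M] *)

Let free_part := [set x | (x \notin u *: B) && (x ^+ 2 \notin B)].
Let W := [set x in D | (x \notin u *: B) && (x ^+ 2 \in B)].

Lemma prod_free_part (H : {group T}) : \prod_(x in D :&: H :&: free_part) x = 1.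
Proof.
have QB : u ^+ Q \in u *: B.
  have [k Ek] : exists k, (Q = (q - 1) * k + 1)%N.
    have /dvdnP[k Ek] : (q - 1 %| Q - 1)%N.
      by rewrite !subn1 dvdn_pred_predX.
    by exists k; rewrite mulnC -Ek subnK // ltnW.
  exact: full_coset_expg Ek.
have BQ2 (x : T) : x ^+ (Q ^ 2).+1 \in B.
  have iB : #|[set: T] : B| = (Q ^ 2).+1.
    apply/eqP; rewrite -(eqn_pmul2l (cardG_gt0 B)) Lagrange ?subsetT // cB.
    by rewrite cardsT cT !addn1.
  by rewrite -iB expg_index.
have QQ (x : T) : x ^+ Q ^+ Q = x ^+ (Q ^ 2) by rewrite -expgM.
apply: (@prod_freely_permuted _ mulT_comm (fun x => x ^+ Q) 4) => //.
- move=> x; rewrite !inE => /andP[/andP[xD xH] /andP[xu x2]].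
  rewrite mem_expq // groupX //=; apply/andP; split; last first.
    by rewrite -expgM mulnC expgM mem_expg_coprime.
  apply: contra xu => xQ; rewrite mem_lcoset -(@mem_expg_coprime _ _ Q) //.
  by rewrite expgMn // expgVn -mem_lcoset (lcoset_eqP QB).
- by move=> x _; rewrite iter_expg expQ4.
- move=> x; rewrite !inE => /andP[_ /andP[_ x2]] /=.
  have f_inj := expg_inj_coprime co_Q.
  (* If x = x^(Q^2) then x^2 = x^(Q^2 + 1) lies in B. The other coincidences reduce to this one. *)
  have ne13 : x != x ^+ Q ^+ Q.
    apply: contra x2 => /eqP E2; rewrite expgS expg1 {2}E2 QQ -expgS.
    exact: BQ2.
  have ne12 : x != x ^+ Q by apply: contraNneq ne13 => E2; rewrite -!E2.
  have ne14 : x != x ^+ Q ^+ Q ^+ Q.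
    apply: contraNneq ne12 => E2; apply/eqP; rewrite {2}E2.
    by rewrite -!expgM -{1}(expQ4 x) !expnS expn0 muln1 !mulnA.
  by rewrite !inE !negb_or !(inj_eq f_inj) ne12 ne13 ne14.
move=> x _; rewrite !big_cons big_nil mulg1 /= -!expgM -!expgD -expgS.
(* The orbit product is x^(1 + Q + Q^2 + Q^3), whose exponent is the group order. *)
have <- : #|T| = (Q + (Q * Q + Q * Q * Q)).+1 by rewrite cT; ring.
exact: expg_cardT.
Qed.

(** To be used for the whole group and for M: the factor over W is common, so only the factors from
    uB remain to be compared. *)
Lemma prod_sub_group (H : {group T}) : W \subset H ->
  \prod_(x in D :&: H) x = \prod_(x in u *: B :&: H) x * \prod_(x in W) x.
Proof.
move=> sWH; rewrite (prod_setID mulT_comm _ free_part) prod_free_part mul1g.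
rewrite (prod_setID mulT_comm _ (u *: B)); congr (_ * _).
  apply: eq_bigl => x; rewrite !inE.
  case: (boolP (x \in u *: B)) => xu; rewrite ?andbF ?andbT //=.
  by rewrite (subsetP suD x xu).
apply: eq_bigl => x; rewrite !inE.
have := subsetP sWH x; rewrite !inE.
case: (x \in u *: B); case: (x ^+ 2 \in B); case: (x \in D); case: (x \in H) => //=.
by move/(_ isT).
Qed.

Lemma prod_coset (H : {group T}) : u \in H ->
  \prod_(x in u *: B :&: H) x = u ^+ #|B :&: H| * \prod_(x in B :&: H) x.
Proof.
move=> uH; have -> : u *: B :&: H = [set u * x | x in B :&: H].
  apply/setP => x; rewrite inE mem_lcoset -[x](mulKVg u).
  rewrite (mem_imset _ _ (mulgI u)) inE mulKg.
  by rewrite (groupMl _ uH).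
rewrite prod_imset //; last by move=> x y _ _; apply: mulgI.
exact: prod_mull.
Qed.

Hypothesis FME : F :=: M.
Hypothesis cR : #|R| = (q + 1)%N.

(** Elements outside M cancel with their inverses: M has odd index, so it contains every
    involution. *)
Lemma prod_B : \prod_(x in B) x = \prod_(x in B :&: M) x.
Proof.
rewrite (prod_setID mulT_comm B M) -[RHS]mulg1; congr (_ * _).
apply: (@prod_freely_permuted _ mulT_comm (fun x => x^-1) 2) => //.
- by move=> x; rewrite !inE !groupV.
- by move=> x _ /=; rewrite invgK.
- move=> x; rewrite !inE => /andP[xM xB]; rewrite /= inE andbT.
  apply: contra xM => /eqP xV; have x2 : x ^+ 2 = 1 by rewrite expgS expg1 {2}xV mulgV.
  have -> : x = x ^+ #|[set: T] : M|.
    rewrite index_M -(odd_double_half (c * e)) odd_ce -mul2n expgD expgM x2.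
    by rewrite expg1n mulg1.
  exact: expg_index.
by move=> x _; rewrite !big_cons big_nil mulg1 mulgV.
Qed.

(** As x^2 is in B and the index of M is odd, x raised to that index is a point z of M in xB. Then x
    is the only point of D in zB, and [mem_F_of_coset] puts it in F = M. *)
Lemma W_sub_M : W \subset M.
Proof.
apply/subsetP => x; rewrite inE => /andP[xD /andP[xu x2]].
pose z := x ^+ #|[set: T] : M|.
have zM : z \in M by apply: expg_index.
have xz : z \in x *: B.
  rewrite mem_lcoset /z index_M -(odd_double_half (c * e)) odd_ce -mul2n expgD.
  by rewrite mulKg expgM groupX.
rewrite -FME; apply: (@mem_F_of_coset z) => //.
- by rewrite FME.
- by apply: contra xu => zu; rewrite -(lcoset_eqP zu) (lcoset_eqP xz) lcoset_refl.
by rewrite (lcoset_eqP xz) lcoset_refl.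
Qed.

Lemma prod_sub_difference_set : \prod_(x in D :&: M) x = 1.
Proof.
have BM : B :&: M = R :> {set T} by rewrite /= FME setIC.
have BT : B :&: [set: T] = B by rewrite setIT.
have DT : D :&: [set: T] = D by rewrite setIT.
have := prodD; rewrite -{1}DT (@prod_sub_group [set: T]%G) ?subsetT //.
rewrite prod_coset ?inE // BT cB prod_B => P1; rewrite -[RHS]P1.
rewrite prod_sub_group ?W_sub_M // prod_coset // BM cR; congr (_ * _ * _).
have uR : u ^+ (q - 1) \in R.
  by rewrite -BM inE full_coset_expq groupX.
(* This yields u^(Q+1) = u^(q+1), because u^(q-1) lies in R, of order q + 1. The divisibility uses
   that s is odd. *)
have /dvdnP[k Ek] : ((q - 1) * (q + 1) %| Q - q)%N.
  rewrite -subn_sqr exp1n /Q -{1}(odd_double_half s) s_odd -mul2n expnD expn1.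
  have -> : (q * q ^ (2 * s./2) - q = q * (q ^ (2 * s./2) - 1))%N.
    by rewrite mulnBr muln1.
  by rewrite dvdn_mull // expnM !subn1 dvdn_pred_predX.
have -> : (Q + 1 = (q - 1) * (q + 1) * k + (q + 1))%N.
  rewrite mulnC -Ek addnA subnK // /Q -{1}(expn1 q) leq_exp2l // prime_gt0 //.
by rewrite [RHS]expgD !expgM -cR (expg_cardG uR) expg1n mul1g.
Qed.

End CommutativeCase.

Local Open Scope group_scope.

Lemma commutative_case (T : finGroupType) (D : {set T}) (M : {group T}) p f q s :
    commutative (@mulg T) -> prime p -> q = (p ^ f)%N -> (1 < q)%N ->
    prime s -> odd s -> (q <= s)%N -> ~~ (s %| q ^ 2 + 1)%N ->
    #|T| = ((q ^ s + 1) * ((q ^ s) ^ 2 + 1))%N ->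
    #|D| = ((q ^ s) ^ 2 + q ^ s + 1)%N ->
    (forall g, g != 1 -> corr D g = (q ^ s + 1)%N) -> \prod_(x in D) x = 1 ->
    #|M| = ((q + 1) * (q ^ 2 + 1))%N ->
  [/\ #|D :&: M| = (q ^ 2 + q + 1)%N,
      forall g, g \in M -> g != 1 -> corr (D :&: M) g = (q + 1)%N
    & \prod_(x in D :&: M) x = 1].
Proof.
move=> mulT_comm p_pr qE q_gt1 s_pr s_odd q_le_s s_ndvd cT cD corD prodD cM.
have [c [e [j [cE eE ceE odd_ce co_e]]]] :=
  index_factorization q_gt1 s_pr s_odd s_ndvd.
have abT : abelian [set: T] by apply/centsP => x _ y _; apply: mulT_comm.
have [B _ cB] : exists2 B : {group T}, B \subset [set: T] & #|B| = (q ^ s + 1)%N.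
  apply: abelian_subgroup_of_order abT _.
  by rewrite cardsT cT dvdn_mulr.
have Q_gt1 : (1 < p ^ (f * s))%N.
  by rewrite expnM -qE -(exp1n s) ltn_exp2r // prime_gt0.
have QE : (q ^ s = p ^ (f * s))%N by rewrite qE expnM.
have DQ : {in D, forall x, x ^+ ((q ^ s) ^ 2) \in D}.
  move=> x xD; rewrite -expnM.
  exact: (mem_expq mulT_comm p_pr qE q_gt1 s_pr cT cD corD prodD).
rewrite QE in cT cD corD DQ cB.
have [u0 suD0 D10] := unique_full_coset mulT_comm p_pr Q_gt1 cT cD corD DQ cB.
rewrite -QE in cT cD corD DQ cB.
pose u := u0 ^+ (c * e).
have uM : u \in M.
  rewrite /u -(index_M cT cM cE eE); exact: (expg_index mulT_comm).
have uB : u *: B = u0 *: B.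
  by apply/lcoset_eqP/(full_coset_expg mulT_comm p_pr qE q_gt1 s_pr cT cD corD
    prodD cB suD0 D10 ceE).
have suD : u *: B \subset D by rewrite uB.
have D1 z : z \notin u *: B -> #|D :&: z *: B| = 1%N by rewrite uB; apply: D10.
pose F := Group (group_Ldiv (q ^ 4 - 1) abT).
have FE x : (x \in F) = (x ^+ (q ^ 4) == x).
  rewrite !inE expg_pred_eq1 // expn_gt0 ltnW //.
have [cR FM cE1 corE] := sub_difference_set mulT_comm p_pr qE q_gt1 s_pr q_le_s
  cT cD corD prodD cM eE co_e cB suD D1 uM FE.
rewrite FM in cE1 corE; split => //.
exact: (prod_sub_difference_set mulT_comm p_pr qE q_gt1 s_pr s_odd cT cD corD
  prodD cM cE eE odd_ce cB suD D1 uM FE FM cR).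
Qed.

(** * Passage to an abelian subgroup of an arbitrary group *)

Lemma prod_perm_abelian (gT : finGroupType) (G : {group gT}) (s t : seq gT) :
    abelian G -> {subset s <= G} -> perm_eq s t ->
  \prod_(x <- s) x = \prod_(x <- t) x.
Proof.
move=> abG; elim: s t => [|x s IH] t sG st.
  by have := perm_size st; case: t {st}.
have xt : x \in t by rewrite -(perm_mem st) mem_head.
have tG : {subset t <= G} by move=> y; rewrite -(perm_mem st) => /sG.
have [xG sG'] : x \in G /\ {subset s <= G}.
  by split=> [|y ys]; apply: sG; rewrite inE ?eqxx ?ys ?orbT.
move: st tG; case/splitPr: xt => t1 t2 st tG.
have {}st : perm_eq s (t1 ++ t2).
  by rewrite -(perm_cons x) (perm_trans st) // -cat1s perm_catCA.
rewrite big_cat !big_cons (IH _ sG' st) big_cat /= !mulgA; congr (_ * _).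
apply: (centsP abG) => //; rewrite big_seq; apply: group_prod => y yt1.
by apply: tG; rewrite mem_cat yt1.
Qed.

Lemma card_pairs_corr (gT : finGroupType) (D : {set gT}) g :
  #|[set x in setX D D | x.1 * x.2^-1 == g]| = corr D g.
Proof.
rewrite /corr -(@card_in_imset _ _ snd); last first.
  move=> [a b] [a' b']; rewrite !inE /= => /andP[_ /eqP E1] /andP[_ /eqP E2] E.
  congr (_, _) => //; rewrite E in E1.
  by apply: (mulIg b'^-1); rewrite E1 E2.
apply: eq_card => y; rewrite [RHS]inE; apply/imsetP/andP => [[[a b]]|[yD gyD]].
  rewrite !inE /= => /andP[/andP[aD bD] /eqP <-] ->.
  by rewrite mulgKV.
by exists (g * y, y); rewrite // !inE /= gyD yD mulgK eqxx.
Qed.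

Section Transfer.
Variables (gT : finGroupType) (G : {group gT}).
Implicit Type D : {set gT}.

(** The ambient type of G need not be commutative, so sets are moved to the type of elements of G,
    which is a commutative group. *)
Definition subg_set (D : {set gT}) : {set subg_of G} := [set x | sgval x \in D].

Lemma imset_subg_set D : D \subset G -> sgval @: subg_set D = D.
Proof.
move=> sDG; apply/setP => x; apply/imsetP/idP => [[y]|xD].
  by rewrite inE => yD ->.
have xG := subsetP sDG x xD.
by exists (subg G x); rewrite ?inE subgK.
Qed.

Lemma card_subg_set D : D \subset G -> #|subg_set D| = #|D|.
Proof. by move=> sDG; rewrite -{2}(imset_subg_set sDG) card_imset //; apply: val_inj. Qed.

Lemma corr_subg_set D g : D \subset G -> corr (subg_set D) g = corr D (sgval g).
Proof.
move=> sDG; rewrite /corr -(card_imset _ val_inj); apply: eq_card => y.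
apply/imsetP/idP => [[x]|].
  by rewrite !inE => /andP[xD gxD] ->; rewrite xD.
rewrite inE => /andP[yD gyD]; have yG := subsetP sDG y yD.
by exists (subg G y); rewrite ?inE /= ?subgK ?yD.
Qed.

Lemma prod_subg_set D : abelian G -> D \subset G ->
  sgval (\prod_(x in subg_set D) x) = \prod_(x in D) x.
Proof.
have morph (x y : subg_of G) : sgval (x * y) = sgval x * sgval y.
  by apply: sgvalM; rewrite inE.
move=> abG sDG; rewrite (big_morph sgval morph (erefl _)).
rewrite -[LHS]big_filter -[RHS]big_filter; set r := [seq x <- _ | x \in subg_set D].
transitivity (\prod_(x <- map sgval r) x); first by rewrite big_map.
(* The two enumerations may list the elements in different orders, which is harmless only because
   all of them lie in G. *)
apply: (prod_perm_abelian abG).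
  by move=> _ /mapP[x _ ->]; apply: valP.
apply: uniq_perm.
- by rewrite map_inj_uniq ?filter_uniq ?index_enum_uniq //; apply: val_inj.
- by rewrite filter_uniq ?index_enum_uniq.
move=> y; rewrite mem_filter mem_index_enum andbT -{1}(imset_subg_set sDG).
apply/mapP/imsetP => -[x xD ->]; exists x => //.
  by rewrite mem_filter in xD; case/andP: xD.
by rewrite mem_filter xD mem_index_enum.
Qed.

End Transfer.

Theorem theorem4p3 (q s : nat) (gT : finGroupType) (G M : {group gT})
  (D : {set gT}) :
  prime_power q -> prime s -> odd s -> (q <= s)%N -> ~~ (s %| q ^ 2 + 1)%N ->
  abelian G ->
  difference_set G D ((q ^ s + 1) * (q ^ (2 * s) + 1))
                     (q ^ (2 * s) + q ^ s + 1) (q ^ s + 1) ->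
  normalized D ->
  M \subset G -> #|M| = ((q + 1) * (q ^ 2 + 1))%N ->
  difference_set M (D :&: M) ((q + 1) * (q ^ 2 + 1)) (q ^ 2 + q + 1) (q + 1)
  /\ normalized (D :&: M).
Proof.
move=> [p [f [p_pr f_gt0 qE]]] s_pr s_odd q_le_s s_ndvd abG.
rewrite /normalized (mulnC 2 s) expnM => -[sDG cG cD corD] nD sMG cM.
have mulT_comm : commutative (@mulg (subg_of G)).
  by move=> x y; apply/val_inj/(centsP abG); apply: valP.
have q_gt1 : (1 < q)%N by rewrite qE -(exp1n f) ltn_exp2r // prime_gt1.
pose M' := (sgval @*^-1 M)%G : {group subg_of G}.
have M'E : M' = subg_set G M :> {set _} by apply/setP => x; rewrite !inE.
have DM'E : subg_set G D :&: M' = subg_set G (D :&: M).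
  by apply/setP => x; rewrite !inE.
have sDMG : D :&: M \subset G by rewrite subIset ?sDG.
have cT : #|subg_of G| = #|G|.
  rewrite -(card_subg_set (subxx G)) -cardsT; apply: eq_card => x.
  by rewrite !inE (valP x).
have cM' : #|M'| = #|M| by rewrite M'E card_subg_set.
have corD' (g : subg_of G) : g != 1 -> corr (subg_set G D) g = (q ^ s + 1)%N.
  by move=> g1; rewrite corr_subg_set // -card_pairs_corr corD ?(valP g).
have prodD' : \prod_(x in subg_set G D) x = 1.
  by apply/val_inj; rewrite /= prod_subg_set.
rewrite -(card_subg_set sDG) in cD.
rewrite -cT in cG; rewrite -cM' in cM.
have [] := commutative_case mulT_comm p_pr qE q_gt1 s_pr s_odd q_le_s s_ndvd
  cG cD corD' prodD' cM.
rewrite DM'E card_subg_set // => cE corE prodE; split.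
  split=> //; [exact: subsetIr | by rewrite -cM' | ].
  move=> g gM g1; have gG := subsetP sMG g gM.
  rewrite card_pairs_corr -(subgK g gG) -corr_subg_set // corE //.
    by rewrite !inE /= subgK.
  by apply: contra g1 => /eqP E; rewrite -(subgK g gG) E.
by rewrite -(prod_subg_set abG sDMG) prodE.
Qed.
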